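(* Let $n\geq 3$, let $\mathcal{D}_n$ be the dihedral group of order $2n$, and let $\mathbb{F}$ be an arbitrary field. Let $m(\mathbb{F}\mathcal{D}_n)$ be the largest degree of the minimal polynomial over $\mathbb{F}$ of an element of the group algebra $\mathbb{F}\mathcal{D}_n$. Then $m(\mathbb{F}\mathcal{D}_n)\leq n+1$ if $n$ is odd, and $m(\mathbb{F}\mathcal{D}_n)\leq n+2$ if $n$ is even.
   Context: For a finite-dimensional associative unital algebra $\mathcal{A}$ over a field $\mathbb{F}$ and $\tau\in\mathcal{A}$, $m(\tau)$ denotes the degree of the minimal polynomial of $\tau$ over $\mathbb{F}$, and $m(\mathcal{A})=\max_{\tau\in\mathcal{A}}m(\tau)$. *)

(* Defs.v *)
From HB Require Import structures.
From mathcomp Require Import all_boot all_order all_algebra.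
From mathcomp Require Import all_fingroup all_solvable all_field.
From mathcomp Require Import boolp.

Set Implicit Arguments.
Unset Strict Implicit.
Unset Printing Implicit Defensive.

Import GRing.Theory.
Local Open Scope ring_scope.

(* The group algebra of gT over F: functions gT -> F with convolution. It is an
   alias of {ffun gT -> F^o} so that the pointwise product on finite functions
   is not picked up. *)
Definition group_algebra (F : fieldType) (gT : finGroupType) : Type :=
  {ffun gT -> F^o}.

Section GroupAlgebra.

Variables (F : fieldType) (gT : finGroupType).
Local Notation A := (group_algebra F gT).
Implicit Types (a b c : A) (g h : gT).

HB.instance Definition _ := Vector.copy A {ffun gT -> F^o}.

Definition group_algebra_one : A := [ffun g => (g == 1%g)%:R : F^o].

Definition group_algebra_mul a b : A :=
  [ffun g => \sum_(h : gT) (a h : F) * b (h^-1 * g)%g : F^o].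

Local Notation "1'" := group_algebra_one.
Local Notation "a ** b" := (group_algebra_mul a b) (at level 40).

Fact group_algebra_mulA : associative group_algebra_mul.
Proof.
move=> a b c; apply/ffunP=> g; rewrite !ffunE.
under eq_bigr do rewrite ffunE mulr_sumr.
under [RHS]eq_bigr do rewrite ffunE mulr_suml.
rewrite [RHS]exchange_big; apply: eq_bigr => h _ /=.
rewrite [RHS](reindex_inj (mulgI h)); apply: eq_bigr => k _ /=.
by rewrite mulKg invMg mulrA !mulgA.
Qed.

Fact group_algebra_mul1l : left_id 1' group_algebra_mul.
Proof.
move=> a; apply/ffunP=> g; rewrite ffunE (bigD1 1%g) //= ffunE eqxx mul1r.
rewrite invg1 mul1g big1 ?addr0 // => h /negPf h1.
by rewrite ffunE h1 mul0r.
Qed.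

Fact group_algebra_mul1r : right_id 1' group_algebra_mul.
Proof.
move=> a; apply/ffunP=> g; rewrite ffunE (bigD1 g) //= ffunE mulVg eqxx mulr1.
rewrite big1 ?addr0 // => h hg.
by rewrite ffunE -eq_mulVg1 (negPf hg) mulr0.
Qed.

Fact group_algebra_mulDl : left_distributive group_algebra_mul +%R.
Proof.
move=> a b c; apply/ffunP=> g; rewrite !ffunE -big_split /=.
by apply: eq_bigr => h _; rewrite ffunE mulrDl.
Qed.

Fact group_algebra_mulDr : right_distributive group_algebra_mul +%R.
Proof.
move=> a b c; apply/ffunP=> g; rewrite !ffunE -big_split /=.
by apply: eq_bigr => h _; rewrite ffunE mulrDr.
Qed.

Fact group_algebra_one_neq0 : 1' != 0 :> A.
Proof.
by apply/eqP => /ffunP/(_ 1%g)/eqP; rewrite !ffunE eqxx oner_eq0.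
Qed.

HB.instance Definition _ := GRing.Zmodule_isNzRing.Build A
  group_algebra_mulA group_algebra_mul1l group_algebra_mul1r
  group_algebra_mulDl group_algebra_mulDr group_algebra_one_neq0.

Fact group_algebra_scaleAl (k : F) a b : k *: (a * b) = (k *: a) * b.
Proof.
apply/ffunP=> g; rewrite !ffunE scaler_sumr; apply: eq_bigr => h _.
by rewrite ffunE; apply: mulrA.
Qed.

HB.instance Definition _ :=
  GRing.Lmodule_isLalgebra.Build F A group_algebra_scaleAl.

Fact group_algebra_scaleAr (k : F) a b : k *: (a * b) = a * (k *: b).
Proof.
apply/ffunP=> g; rewrite !ffunE scaler_sumr; apply: eq_bigr => h _.
by rewrite ffunE; apply: mulrCA.
Qed.

HB.instance Definition _ :=
  GRing.Lalgebra_isAlgebra.Build F A group_algebra_scaleAr.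

HB.instance Definition _ := Algebra_isFalgebra.Build F A.

End GroupAlgebra.

Section MinimalPolynomial.

Variables (F : fieldType) (A : falgType F).
Implicit Types (t : A) (p q : {poly F}).

Definition is_min_poly t p :=
  [/\ p \is monic, horner_alg t p = 0 &
      forall q, q \is monic -> horner_alg t q = 0 -> (size p <= size q)%N].

Lemma monic_annihilator t :
  exists p, [/\ p \is monic, horner_alg t p = 0 & (size p <= (\dim {:A}).+1)%N].
Proof.
pose X := [tuple t ^+ i | i < (\dim {:A}).+1].
have /(elimN freeP) nfX : ~~ free X.
  apply/negP.
  move=> fX; have := dimvS (subvf <<X>>%VS).
  by rewrite (eqP fX) size_tuple ltnn.
have [k [k0 [i ki]]] : exists k : 'I_(\dim {:A}).+1 -> F,
    \sum_i k i *: X`_i = 0 /\ exists i, k i != 0.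
  apply: contrapT => nk; apply: nfX => k k0 i; apply/eqP.
  by case: eqP => // /eqP ki; case: nk; exists k; split=> //; exists i.
pose p := \poly_(j < (\dim {:A}).+1) k (inord j).
have p0 : p != 0.
  apply/eqP => /(congr1 (fun q : {poly F} => q`_i)); rewrite coef0 coef_poly ltn_ord.
  by rewrite inord_val => /eqP; rewrite (negPf ki).
have pt : horner_alg t p = 0.
  rewrite -k0 /p poly_def raddf_sum; apply: eq_bigr => j _ /=.
  rewrite -(tnth_nth 0 X) tnth_mktuple linearZ rmorphXn /=.
  by rewrite inord_val mulr_algl horner_algX.
have lp : (lead_coef p)^-1 != 0 by rewrite invr_eq0 lead_coef_eq0.
exists ((lead_coef p)^-1 *: p); split.
- by rewrite monicE lead_coefZ mulVf // lead_coef_eq0.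
- by rewrite linearZ /= pt mulr0.
- by rewrite size_scale // size_poly.
Qed.

Lemma min_poly_exists t : exists p, is_min_poly t p.
Proof.
pose P n := `[< exists p, [/\ p \is monic, horner_alg t p = 0 & size p = n] >].
have exP : exists n, P n.
  by have [p [? ? _]] := monic_annihilator t; exists (size p); apply/asboolP; exists p.
have [n /asboolP[p [mp pt sp]] minn] := ex_minnP exP.
exists p; split=> // q mq qt; rewrite sp; apply: minn.
by apply/asboolP; exists q.
Qed.

Definition min_poly t : {poly F} := projT1 (cid (min_poly_exists t)).

Lemma min_polyP t : is_min_poly t (min_poly t).
Proof. exact: projT2 (cid (min_poly_exists t)). Qed.

Definition min_poly_degree t : nat := (size (min_poly t)).-1.

Lemma min_poly_degree_le t : (min_poly_degree t <= \dim {:A})%N.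
Proof.
have [p [mp pt sp]] := monic_annihilator t.
have [_ _ /(_ p mp pt) le] := min_polyP t.
have := leq_trans le sp; rewrite /min_poly_degree.
by case: (size _).
Qed.

Definition is_min_poly_degree (d : nat) : bool :=
  `[< exists t, min_poly_degree t = d >].

Lemma is_min_poly_degree_ex : exists d, is_min_poly_degree d.
Proof. by exists (min_poly_degree 0); apply/asboolP; exists 0. Qed.

Lemma is_min_poly_degree_le d : is_min_poly_degree d -> (d <= \dim {:A})%N.
Proof. by move=> /asboolP[t <-]; apply: min_poly_degree_le. Qed.

Definition max_min_poly_degree : nat :=
  ex_maxn is_min_poly_degree_ex is_min_poly_degree_le.

End MinimalPolynomial.

Arguments max_min_poly_degree {F} A.

(* Main.v *)
(* Let x generate the rotations, let W be the span of 1 and the x^i + x^-i, and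
   let t' be the image of t under the linear map with r |-> r^-1 on rotations
   and s |-> -s on reflections. Then W is a subalgebra of dimension at most
   n/2 + 1 that contains t + t' and t' t, so t^2 = (t + t') t - t' t lies in
   W t + W. Hence W t + W is stable under right multiplication by t and contains
   1, and the degree of the minimal polynomial of t is at most its dimension,
   which is at most 2 (n/2 + 1). *)
Require Import Defs.
From HB Require Import structures.
From mathcomp Require Import all_boot all_order all_algebra.
From mathcomp Require Import all_fingroup all_solvable all_field.

Set Implicit Arguments.
Unset Strict Implicit.
Unset Printing Implicit Defensive.

Import GRing.Theory.

(** * Degree bounds from subspaces stable under multiplication *)

Section Degree.

Local Open Scope ring_scope.

Variables (F : fieldType) (A : falgType F).
Implicit Types (W V : {vspace A}) (t : A).

(** All powers of [t] lie in [V], so evaluation at [t] sends the space of polynomials of size at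
    most [m.+1], of dimension [m.+1], into a space of dimension [m]; a nonzero polynomial is
    killed. *)
Lemma min_poly_degree_le_dim V t :
  1 \in V -> {in V, forall v, v * t \in V} -> (min_poly_degree t <= \dim V)%N.
Proof.
move=> V1 Vt; set m := \dim V.
have Vexp i : t ^+ i \in V by elim: i => // i IH; rewrite exprSr Vt.
pose ev (u : 'rV[F]_m.+1) : A := horner_alg t (rVpoly u).
have ev_linear : linear ev.
  by move=> a u v; rewrite /ev linearP linearD linearZ /= mulr_algl.
pose evL := HB.pack_for {linear 'rV[F]_m.+1 -> A} ev
  (GRing.isLinear.Build F _ _ _ ev ev_linear).
pose phi : 'Hom('rV[F]_m.+1, A) := linfun evL.
have phiE u : phi u = horner_alg t (rVpoly u) by rewrite lfunE.
have im_phi : (limg phi <= V)%VS.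
  apply/subvP=> _ /memv_imgP[u _ ->].
  rewrite phiE -[rVpoly u]coefK poly_def raddf_sum; apply: memv_suml => i _.
  by rewrite /= linearZ rmorphXn /= horner_algX mulr_algl memvZ.
have : lker phi != 0%VS.
  apply: contraTneq (dimvS im_phi) => ker0.
  have := limg_ker_dim phi fullv.
  by rewrite ker0 capv0 dimv0 add0n dimvf /dim /= mul1n -ltnNge => ->.
rewrite -vpick0; set u := vpick _ => u_neq0.
have : u \in lker phi by apply: memv_pick.
rewrite memv_ker phiE => /eqP pt; set p := rVpoly u in pt.
have p_neq0 : p != 0.
  by apply: contraNneq u_neq0 => p0; rewrite -[u]rVpolyK -/p p0 linear0.
have lp : (lead_coef p)^-1 != 0 by rewrite invr_eq0 lead_coef_eq0.
have [_ _ min_p] := min_polyP t.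
have := min_p ((lead_coef p)^-1 *: p); rewrite monicE lead_coefZ linearZ /= pt.
rewrite mulVf ?lead_coef_eq0 // mulr0 eqxx size_scale // => /(_ isT erefl) le_p.
have := leq_trans le_p (size_poly _ _).
by rewrite /min_poly_degree; case: size.
Qed.

Lemma min_poly_degree_le_quadratic W t :
    1 \in W -> (W * W <= W)%VS -> t * t \in (W * <[t]> + W)%VS ->
  (min_poly_degree t <= (\dim W).*2)%N.
Proof.
move=> W1 WW tt; set V := (W * <[t]> + W)%VS.
apply: (@leq_trans (\dim V)); last first.
  apply: leq_trans (dimv_add_leqif _ _) _; rewrite -addnn leq_add2r.
  apply: leq_trans (dim_prodv _ _) _.
  by rewrite dim_vline -[leqRHS]muln1 leq_mul2l leq_b1 orbT.
apply: min_poly_degree_le_dim; first by rewrite (subvP (addvSr _ _)).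
move=> v Vv; have: v * t \in (V * <[t]>)%VS by rewrite memv_mul ?memv_line.
(* [V * <[t]>] splits into [W * <[t]>], already in [V], and [W * <[t * t]>], which [tt] and [WW]
   bring back into [V]. *)
apply/subvP; rewrite prodvDl subv_add addvSl andbT -prodvA prodv_line.
apply: subv_trans (prodvSr W tt) _.
by rewrite prodvDr prodvA addvS // prodvSl.
Qed.

(** Pairing the terms (i, j) and (j, i) reduces a quadratic expression to its diagonal and polar
    parts without dividing by 2, so characteristic 2 is covered. *)
Lemma double_sum_mem W (I : Type) (s : seq I) (c : I -> F) (M : I -> I -> A) :
    (forall i, M i i \in W) -> (forall i j, M i j + M j i \in W) ->
  \sum_(i <- s) \sum_(j <- s) (c i * c j) *: M i j \in W.
Proof.
move=> Mii Mij; elim: s => [|k s IH]; first by rewrite big_nil mem0v.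
rewrite big_cons; under [X in _ + X]eq_bigr do rewrite big_cons.
rewrite big_cons big_split /= -addrA [X in _ + X]addrA -big_split /=.
rewrite memvD ?memvZ // memvD //; apply: memv_suml => i _.
by rewrite [c i * _]mulrC -scalerDr memvZ.
Qed.

End Degree.

(** * Rotations and reflections in the dihedral group *)

Lemma dihedral_rotation (n : nat) : 1 < n ->
  exists x : dihedral_gtype n.*2,
    [/\ (x ^+ n = 1)%g,
        forall g, g \notin <[x]>%g -> (g * g = 1)%g &
        forall g h, g \notin <[x]>%g -> h \notin <[x]>%g -> (g * h \in <[x]>)%g].
Proof.
move=> n_gt1; have [_] := isoGrpP _ (Grp_dihedral n_gt1) (isog_refl _).
case/existsP=> -[x y] /=; case/eqP=> defG xn y2 xy; exists x.
have y1 : (y * y = 1)%g by rewrite -y2.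
have gE g : g \notin <[x]>%g -> exists2 r, r \in <[x]>%g & g = (r * y)%g.
  move=> gNx; have : g \in (<[x]> * <[y]>)%g.
    by rewrite -norm_joinEr ?norms_cycle ?xy ?groupV ?cycle_id // defG inE.
  case/mulsgP=> r _ rx /cycleP[j ->] gE; exists r => //.
  (* Only the parity of [j] matters, and an even [j] would make [g] a rotation. *)
  move: gNx; rewrite gE -(expg_mod j y2) modn2; case: (odd j) => //.
  by rewrite expg0 mulg1 rx.
have yr r : r \in <[x]>%g -> (y * r * y = r^-1)%g.
  case/cycleP=> i ->; rewrite -expgVn -xy -conjXg conjgE mulgA.
  by have /eqP-> : (y^-1 == y)%g by rewrite eq_invg_mul y1.
split=> // [g /gE[r rx ->]|g h /gE[r rx ->] /gE[r' rx' ->]].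
  by rewrite -mulgA (mulgA y) yr // mulgV.
by rewrite -mulgA (mulgA y) yr // groupM ?groupV.
Qed.

(** * The basis of group elements *)

Section GroupElements.

Local Open Scope ring_scope.

Variables (F : fieldType) (gT : finGroupType).
Local Notation A := (group_algebra F gT).
Implicit Types (g h : gT).

Definition ga_of g : A := [ffun h => (h == g)%:R : F^o].

Lemma ga_of1 : ga_of 1%g = 1.
Proof. by []. Qed.

Lemma ga_ofM g h : ga_of (g * h)%g = ga_of g * ga_of h.
Proof.
apply/ffunP=> k; rewrite !ffunE (bigD1 g) //= !ffunE eqxx mul1r.
rewrite big1 ?addr0 => [|g' /negPf ne_g]; last by rewrite ffunE ne_g mul0r.
by congr (_ %:R); rewrite -[in RHS](inj_eq (mulgI g)) mulKVg.
Qed.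

Lemma ga_sum (t : A) : t = \sum_g (t g : F) *: ga_of g.
Proof.
apply/ffunP=> k; rewrite sum_ffunE (bigD1 k) //= !ffunE eqxx.
rewrite big1 ?addr0 => [|g ne_g]; first by rewrite [_ *: _]mulr1.
by rewrite !ffunE eq_sym (negPf ne_g) scaler0.
Qed.

End GroupElements.

(** * Trace and norm over the symmetric rotations *)

Section DihedralLike.

Local Open Scope ring_scope.

Variables (F : fieldType) (gT : finGroupType) (n : nat) (x : gT).
Hypothesis n_gt0 : (0 < n)%N.
Hypothesis xn : (x ^+ n = 1)%g.
Hypothesis refl_invol : forall g, g \notin <[x]>%g -> (g * g = 1)%g.
Hypothesis refl_mul :
  forall g h, g \notin <[x]>%g -> h \notin <[x]>%g -> (g * h \in <[x]>)%g.

Local Notation A := (group_algebra F gT).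
Local Notation U := (@ga_of F gT).
Implicit Types (g h z w : gT) (t : A).

Definition sym_rot z : A := U z + U z^-1%g.

(* The generator 1 is listed separately because sym_rot 1 = 2 vanishes in
   characteristic 2. For even n the generator x^(n/2) is deliberately absent:
   sym_rot (x^(n/2)) = 2 x^(n/2) is all that the argument needs. *)
Definition sym_space : {vspace A} :=
  <<1%R :: [seq sym_rot (x ^+ i)%g | i <- iota 1 n./2]>>%VS.

Lemma dim_sym_space : (\dim sym_space <= n./2.+1)%N.
Proof. by apply: leq_trans (dim_span _) _; rewrite /= size_map size_iota. Qed.

Lemma sym_space1 : 1 \in sym_space.
Proof. by rewrite memv_span // mem_head. Qed.

Lemma sym_rotV z : sym_rot z^-1%g = sym_rot z.
Proof. by rewrite /sym_rot invgK addrC. Qed.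

(** For 0 < i < n, one of the exponents i and n - i is at most [n./2], and both give the same
    symmetric element; i = 0 gives 1 + 1. *)
Lemma sym_rot_mem z : z \in <[x]>%g -> sym_rot z \in sym_space.
Proof.
case/cycleP=> i ->; rewrite -(expg_mod i xn).
move: (i %% n)%N (ltn_pmod i n_gt0) => {i} [_|i lt_in].
  by rewrite expg0 /sym_rot invg1 ga_of1 memvD ?sym_space1.
have mem_small j : (0 < j <= n./2)%N -> sym_rot (x ^+ j)%g \in sym_space.
  move=> lej; rewrite memv_span // inE; apply/orP; right.
  by apply: (map_f (fun i => sym_rot (x ^+ i)%g)); rewrite mem_iota add1n ltnS.
have [le_i|lt_i] := leqP i.+1 n./2; first exact: mem_small.
have xV : ((x ^+ i.+1)^-1 = x ^+ (n - i.+1))%g.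
  by apply/eqP; rewrite eq_invg_mul -expgD subnKC ?xn // ltnW.
rewrite -sym_rotV xV mem_small // subn_gt0 lt_in /= leq_subLR.
by rewrite -{1}[n]odd_double_half -addnn addnA leq_add2r; case: odd lt_i => // /ltnW.
Qed.

(** The analogue of 2 cos a * 2 cos b = 2 cos (a + b) + 2 cos (a - b). *)
Lemma sym_rotM z w : z \in <[x]>%g -> w \in <[x]>%g ->
  sym_rot z * sym_rot w = sym_rot (z * w)%g + sym_rot (z * w^-1)%g.
Proof.
move=> zx wx; have cx := centsP (cycle_abelian x).
rewrite /sym_rot mulrDl !mulrDr -!ga_ofM !invMg invgK.
rewrite [(w^-1 * z^-1)%g]cx ?groupV // [(w * z^-1)%g]cx ?groupV //.
by rewrite [X in _ + X = _]addrC addrACA.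
Qed.

Lemma sym_spaceM : (sym_space * sym_space <= sym_space)%VS.
Proof.
have gen_rot u : u \in 1 :: [seq sym_rot (x ^+ i)%g | i <- iota 1 n./2] ->
    u = 1 \/ exists2 z, z \in <[x]>%g & u = sym_rot z.
  rewrite inE => /predU1P[|/mapP[i _ ->]]; first by left.
  by right; exists (x ^+ i)%g; rewrite ?mem_cycle.
(* Both spans are expanded into sums of lines, leaving products of two generators. *)
rewrite {1 2}/sym_space !span_def big_distrl big_seq /=.
apply: (big_ind (fun V => V <= sym_space)%VS) => [|V W sV sW|u uX].
- exact: sub0v.
- by rewrite subv_add sV.
rewrite big_distrr big_seq /=.
apply: (big_ind (fun V => V <= sym_space)%VS) => [|V W sV sW|v vX].
- exact: sub0v.
- by rewrite subv_add sV.
rewrite prodv_line -memvE.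
case: (gen_rot u uX) => [->|[z zx ->]]; first by rewrite mul1r memv_span.
case: (gen_rot v vX) => [->|[w wx ->]]; first by rewrite mulr1 sym_rot_mem.
by rewrite sym_rotM // memvD // sym_rot_mem // groupM ?groupV.
Qed.

(** When rotations act as diag(a, a^-1) and reflections as antidiagonal matrices with entries b,
    b^-1, this is the 2 by 2 adjugate; hence the trace and norm below. *)
Definition conj_elt g : A := if g \in <[x]>%g then U g^-1%g else - U g.

Definition ga_conj t : A := \sum_g (t g : F) *: conj_elt g.

Lemma ga_trace_mem t : t + ga_conj t \in sym_space.
Proof.
rewrite {1}[t]ga_sum /ga_conj -big_split; apply: memv_suml => g _ /=.
rewrite -scalerDr memvZ // /conj_elt; case: ifP => gx.
  exact: sym_rot_mem.
by rewrite addrN mem0v.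
Qed.

(** Since [g * h] is again a reflection, g h g h = 1 = h h. *)
Lemma refl_rotJ g h : g \in <[x]>%g -> h \notin <[x]>%g ->
  (h * g = g^-1 * h)%g.
Proof.
move=> gx hx; have ghx : (g * h)%g \notin <[x]>%g by rewrite groupMl.
apply: (mulgI g); rewrite mulKVg; apply: (mulIg h).
by rewrite refl_invol // -(refl_invol ghx) !mulgA.
Qed.

Lemma conj_eltM g : conj_elt g * U g \in sym_space.
Proof.
rewrite /conj_elt; case: ifPn => gx; rewrite ?mulNr -ga_ofM.
  by rewrite mulVg ga_of1 sym_space1.
by rewrite refl_invol // ga_of1 memvN sym_space1.
Qed.

(** Two rotations give g^-1 h plus its inverse, two reflections give minus the sum of g h and its
    inverse, and in the mixed case the terms cancel. *)
Lemma conj_elt_polar g h :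
  conj_elt g * U h + conj_elt h * U g \in sym_space.
Proof.
(* By symmetry, in the mixed case [g] is the rotation. *)
wlog: g h / (h \in <[x]>%g) ==> (g \in <[x]>%g) => [wl|].
  have [|] := boolP ((h \in <[x]>%g) ==> (g \in <[x]>%g)); first exact: wl.
  by rewrite negb_imply addrC => /andP[hx _]; apply: wl; rewrite hx implybT.
rewrite /conj_elt; case: (ifPn (h \in _)) => hx /= gx.
  rewrite gx -!ga_ofM -[(h^-1 * g)%g]invgK invMg invgK.
  by apply: sym_rot_mem; rewrite groupM ?groupV.
case: ifPn => {}gx; rewrite ?mulNr -!ga_ofM.
  by rewrite (refl_rotJ gx hx) subrr mem0v.
have -> : (h * g = (g * h)^-1)%g.
  apply/eqP; rewrite eq_sym eq_invg_mul mulgA -(mulgA g).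
  by rewrite !refl_invol ?mulg1 ?refl_invol.
by rewrite -opprD memvN sym_rot_mem ?refl_mul.
Qed.

Lemma ga_norm_mem t : ga_conj t * t \in sym_space.
Proof.
rewrite {2}[t]ga_sum /ga_conj mulr_suml.
under eq_bigr => g _ do
  (rewrite mulr_sumr; under eq_bigr => h _ do
     rewrite -scalerAl -scalerAr scalerA).
by apply: double_sum_mem; [apply: conj_eltM | apply: conj_elt_polar].
Qed.

Lemma min_poly_degree_dihedral_like t :
  (min_poly_degree t <= (n./2.+1).*2)%N.
Proof.
apply: leq_trans (_ : (\dim sym_space).*2 <= _)%N; last first.
  by rewrite leq_double dim_sym_space.
apply: min_poly_degree_le_quadratic sym_space1 sym_spaceM _.
have -> : t * t = (t + ga_conj t) * t - ga_conj t * t by rewrite mulrDl addrK.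
by rewrite memv_add ?memvN ?ga_norm_mem // memv_mul ?ga_trace_mem ?memv_line.
Qed.

End DihedralLike.

Theorem theorem4p13 (F : fieldType) (n : nat) (hn : 3 <= n) :
  (odd n ->
     max_min_poly_degree (group_algebra F (dihedral_gtype (n.*2))) <= n + 1) /\
  (~~ odd n ->
     max_min_poly_degree (group_algebra F (dihedral_gtype (n.*2))) <= n + 2).
Proof.
have [x [xn refl_invol refl_mul]] := dihedral_rotation (ltnW hn).
rewrite /max_min_poly_degree; case: ex_maxnP => d /boolp.asboolP[t <-] _.
have n_gt0 : 0 < n by apply: leq_trans hn.
have le_t := min_poly_degree_dihedral_like n_gt0 xn refl_invol refl_mul t.
(* The bound [(n./2.+1).*2] equals n + 1 for odd n and n + 2 for even n. *)
have nE := odd_double_half n.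
split=> [odd_n | /negPf odd_n]; rewrite odd_n in nE; apply: leq_trans le_t _.
  by rewrite -[X in _ <= X + _]nE doubleS addn1.
by rewrite -[X in _ <= X + _]nE doubleS addn2.
Qed.
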